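(* Let $C\subseteq\mathbb{F}_2^N$ be any linear code with dual code $C^\perp\subseteq\mathbb{F}_2^N$. Then for any $\epsilon\in(0,\frac12)$ satisfying $N>\frac{1}{\epsilon^4(\frac12-\epsilon)^4}$, there exists a decoding function $d:\mathbb{F}_2^N\to C$ such that for all $c\in C$, $$\Pr_{\rho\sim P_\epsilon}[d(c+\rho)\neq c]\leq 2e^{-\frac{\sqrt N}{3\epsilon}}+N\max_{\substack{S\subseteq[\epsilon N-N^{3/4},\,\epsilon N+N^{3/4}]\cap\mathbb{N}\\ 1\leq|S|\leq 2}}\Big\{\frac{1}{\binom{N}{S}}\,\mathbb{E}_{y\sim\mathcal{D}(C^\perp)}\big[K_S(\mathrm{wt}(y))^2\big]-1\Big\}.$$
   Context: $\mathrm{wt}(x)$ is the Hamming weight of $x\in\mathbb{F}_2^N$. $P_\epsilon$ is the distribution on $\mathbb{F}_2^N$ given by $P_\epsilon(z)=\epsilon^{\mathrm{wt}(z)}(1-\epsilon)^{N-\mathrm{wt}(z)}$. $\mathcal{D}(X)$ is the uniform distribution on a finite set $X$. The dual code $C^\perp$ is the orthogonal complement of $C$ in $\mathbb{F}_2^N$ for the standard dot product. $\mathbb{N}=\{0,1,2,\dots\}$. For $S\subseteq\{0,1,\dots,N\}$, $\binom{N}{S}:=\sum_{j\in S}\binom{N}{j}$ and $K_S(x):=\sum_{j\in S}K_j(x)$, where the Krawtchouk polynomial of degree $s$ is $K_s(x):=\sum_{j=0}^s(-1)^j\binom{x}{j}\binom{N-x}{s-j}$, with $\binom{p(x)}{j}:=\frac{p(x)(p(x)-1)\cdots(p(x)-j+1)}{j!}$.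 *)

(* Defs.v *)
From HB Require Import structures.
From mathcomp Require Import all_boot all_order all_algebra.
From mathcomp Require Import all_classical all_reals all_analysis.

Set Implicit Arguments.
Unset Strict Implicit.
Unset Printing Implicit Defensive.

Import Order.TTheory GRing.Theory Num.Theory.
Local Open Scope ring_scope.

Definition wt (N : nat) (x : 'rV['F_2]_N) : nat := #|[set i | x 0 i != 0]%SET|.

Definition dotp (N : nat) (x y : 'rV['F_2]_N) : 'F_2 :=
  \sum_(i < N) x 0 i * y 0 i.

Definition dual_code (N : nat) (C : {vspace 'rV['F_2]_N}) : {set 'rV['F_2]_N} :=
  [set y | [forall x, (x \in C) ==> (dotp x y == 0)]]%SET.

Definition Pnoise (R : realType) (N : nat) (eps : R) (z : 'rV['F_2]_N) : R :=
  eps ^+ wt z * (1 - eps) ^+ (N - wt z).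

Definition Prob (R : realType) (T : finType) (P : T -> R) (A : pred T) : R :=
  \sum_(z | A z) P z.

Definition Eunif (R : realType) (T : finType) (X : {set T}) (f : T -> R) : R :=
  (\sum_(y in X) f y) / #|X|%:R.

(* p (p - 1) ... (p - j + 1) / j! *)
Definition binp (R : realType) (p : {poly R}) (j : nat) : {poly R} :=
  (j`!%:R)^-1 *: \prod_(i < j) (p - i%:R).

Definition Krawtchouk (R : realType) (N s : nat) : {poly R} :=
  \sum_(j < s.+1) (-1) ^+ j *: (binp 'X j * binp (N%:R - 'X) (s - j)).

Definition KrawtchoukS (R : realType) (N : nat) (S : {set 'I_N.+1}) : {poly R} :=
  \sum_(j in S) Krawtchouk R N j.

Definition binom_set (N : nat) (S : {set 'I_N.+1}) : nat := (\sum_(j in S) 'C(N, j))%N.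

(* Subsets of {0, ..., N} lose nothing: when N > 1 / (eps^4 (1/2 - eps)^4) with
   0 < eps < 1/2, one has N^(3/4) < eps (1/2 - eps) N, so the whole window
   lies below N / 2. *)
Definition in_window (R : realType) (N : nat) (eps : R) (S : {set 'I_N.+1}) : bool :=
  [forall s in S,
    eps * N%:R - N%:R `^ (3 / 4) <= (s : nat)%:R <= eps * N%:R + N%:R `^ (3 / 4)]
  && (1 <= #|S| <= 2)%N.

(* A supremum rather than an iterated max, so that no default value takes part
   in the comparison; finmaxP shows that it is attained. *)
Definition finmax (R : realType) (T : finType) (P : pred T) (F : T -> R) : R :=
  sup [set F x | x in [set x | P x]]%classic.

Lemma finmaxP (R : realType) (T : finType) (P : pred T) (F : T -> R) (x0 : T) :
  P x0 -> exists2 x, P x &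
    finmax P F = F x /\ forall y, P y -> F y <= F x.
Proof.
move=> Px0; case: (@arg_maxP _ _ T x0 P F Px0) => x Px le_x.
exists x => //; split=> //; apply/eqP; rewrite eq_le; apply/andP; split.
  by apply: ge_sup; [exists (F x0), x0 | move=> _ [y Py <-]; exact: le_x].
apply: ub_le_sup; last by exists x.
by exists (F x) => _ [y Py <-]; exact: le_x.
Qed.

(* Main.v *)
(* For [B] the union of the spheres with radii in [S], [K_S (wt y)] is the
   character sum of [B] at [y]; averaging its square over the dual code counts
   the pairs of [B] that are congruent modulo [C], of which [#|B|] are diagonal.
   The bracket in the bound is thus the mean number of collisions of a point of
   [B] with other points of [B] in its coset.  Decode to a codeword whose error
   pattern has minimal weight within the window: an error of weight [i] in the
   window is then misdecoded only after a collision with an error of weight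
   [j <= i] in the window, and a union bound over the at most [N] values of [j]
   gives the second term.  Spheres of radius [j <= i <= N / 2] satisfy
   ['C(N, j) <= 'C(N, i)], so two-element sets [S] suffice.  The first term is a
   Chernoff bound for weights outside the window. *)
Require Import Defs.
From HB Require Import structures.
From mathcomp Require Import all_boot all_order all_algebra.
From mathcomp Require Import all_classical all_reals all_analysis.
From mathcomp Require Import ring lra zify.

Set Implicit Arguments.
Unset Strict Implicit.
Unset Printing Implicit Defensive.

Import Order.TTheory GRing.Theory Num.Theory.
Local Open Scope ring_scope.

(** * Product sums over binary vectors *)

Lemma sum_rV_prod (A : comNzRingType) (T : finType) (N : nat)
    (G : 'I_N -> T -> A) :
  \sum_(z : 'rV[T]_N) \prod_(i < N) G i (z 0 i) = \prod_(i < N) \sum_(a : T) G i a.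
Proof.
rewrite bigA_distr_bigA /=.
rewrite (reindex (fun f : {ffun 'I_N -> T} => \row_i f i)) /=.
  by apply: eq_bigr => f _; apply: eq_bigr => i _; rewrite mxE.
exists (fun z : 'rV[T]_N => [ffun i => z 0 i]) => [f _|z _].
  by apply/ffunP => i; rewrite ffunE mxE.
by apply/rowP => i; rewrite mxE ffunE.
Qed.

Lemma sum_F2 (A : nmodType) (f : 'F_2 -> A) : \sum_a f a = f 0 + f 1.
Proof.
rewrite big_ord_recl big_ord_recl big_ord0 addr0; congr (f _ + f _); exact/val_inj.
Qed.

Lemma prod_exp_card (A : comNzRingType) (N : nat) (P : pred 'I_N) (a b : A) :
  \prod_(i < N) (if P i then a else b) = a ^+ #|P| * b ^+ (N - #|P|).
Proof.
rewrite (bigID P) /= (eq_bigr (fun=> a)); last by move=> i ->.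
rewrite [X in _ * X](eq_bigr (fun=> b)); last by move=> i /negbTE ->.
rewrite !prodr_const; congr (_ * _ ^+ _).
by have /(congr1 (subn^~ #|P|)) := cardC P; rewrite card_ord addKn.
Qed.

Lemma prod_exp_wt (A : comNzRingType) (N : nat) (z : 'rV['F_2]_N) (a b : A) :
  \prod_(i < N) (if z 0 i != 0 then a else b) = a ^+ wt z * b ^+ (N - wt z).
Proof. by rewrite prod_exp_card /wt cardsE. Qed.

Lemma sum_wt_prod (A : comNzRingType) (N : nat) (a b : A) :
  \sum_(z : 'rV['F_2]_N) a ^+ wt z * b ^+ (N - wt z) = (a + b) ^+ N.
Proof.
under eq_bigr do rewrite -prod_exp_wt.
rewrite (sum_rV_prod (fun _ (c : 'F_2) => if c != 0 then a else b)).
by rewrite big_const_ord iter_mulr mulr1 sum_F2 eqxx oner_eq0 /= addrC.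
Qed.

Lemma wt_le (N : nat) (z : 'rV['F_2]_N) : (wt z <= N)%N.
Proof. by rewrite /wt -[leqRHS]card_ord max_card. Qed.

(** * The nontrivial additive character of [F_2] and Krawtchouk polynomials *)

Definition chi (R : realType) (a : 'F_2) : R := (-1) ^+ (a != 0).

Lemma F2P (a : 'F_2) : a = 0 \/ a = 1.
Proof. by case: a => -[|[|//]] i; [left|right]; exact/val_inj. Qed.

Lemma chiD (R : realType) (a b : 'F_2) : chi R (a + b) = chi R a * chi R b.
Proof.
rewrite /chi; case: (F2P a) => ->; last case: (F2P b) => ->.
- by rewrite add0r eqxx mul1r.
- by rewrite addr0 eqxx mulr1.
have -> : 1 + 1 = 0 :> 'F_2 by exact/val_inj.
by rewrite eqxx oner_eq0 expr0 expr1 mulrNN mulr1.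
Qed.

Lemma chi_sum (R : realType) (I : finType) (f : I -> 'F_2) :
  chi R (\sum_i f i) = \prod_i chi R (f i).
Proof.
by apply: (big_morph (chi R) (@chiD R)); rewrite /chi eqxx.
Qed.

Lemma binp_horner (R : realType) (p : {poly R}) (j m : nat) (x : R) :
  p.[x] = m%:R -> (binp p j).[x] = 'C(m, j)%:R.
Proof.
move=> px; rewrite /binp hornerZ horner_prod.
have j0 : (j`!%:R : R) != 0 by rewrite pnatr_eq0 -lt0n fact_gt0.
apply: (mulfI j0); rewrite mulrA mulfV // mul1r -natrM mulnC bin_ffact.
elim: j {j0} => [|j IH]; first by rewrite big_ord0 ffactn0.
rewrite big_ord_recr /= IH ffactnSr hornerD hornerN px -polyC_natr hornerC natrM.
(* For [m < j] the truncated [m - j] is not the real difference, but the falling factorial it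
   multiplies is already zero. *)
have [jm|mj] := leqP j m; first by rewrite natrB.
by rewrite ffact_small ?mul0r.
Qed.

(* [K_s (wt y)] and the character sum over the sphere of radius [s] are both the
   coefficient of [X^s] in [(1 - X) ^ (wt y) * (1 + X) ^ (N - wt y)]. *)
Lemma Krawtchouk_chi (R : realType) (N s : nat) (y : 'rV['F_2]_N) :
  (Krawtchouk R N s).[(wt y)%:R] = \sum_(z | wt z == s) chi R (dotp y z).
Proof.
pose w := wt y.
have coefD1 (c : R) n k : ((1 + c *: 'X) ^+ n)`_k = c ^+ k * 'C(n, k)%:R.
  rewrite exprDn coef_sum.
  under eq_bigr do rewrite expr1n mul1r exprZn coefMn coefZ coefXn.
  have [kn|nk] := leqP k n.
    rewrite (bigD1 (Ordinal (kn : (k < n.+1)%N))) //= eqxx mulr1 mulr_natr.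
    rewrite big1 ?addr0 // => i; rewrite -val_eqE /= eq_sym => /negbTE ->.
    by rewrite mulr0 mul0rn.
  rewrite bin_small // mulr0 big1 // => i _.
  by rewrite gtn_eqF ?mulr0 ?mul0rn // (leq_ltn_trans _ nk) // -ltnS.
have -> : (Krawtchouk R N s).[w%:R] =
    (((1 + (-1) *: 'X) ^+ w * (1 + 1 *: 'X) ^+ (N - w)) : {poly R})`_s.
  rewrite coefM /Krawtchouk horner_sum; apply: eq_bigr => j _.
  rewrite !coefD1 expr1n mul1r hornerZ hornerM mulrA.
  rewrite (@binp_horner _ _ _ w) ?hornerX // (@binp_horner _ _ _ (N - w)%N) //.
  by rewrite hornerD hornerN hornerX -polyC_natr hornerC natrB ?wt_le.
rewrite -prod_exp_wt.
(* Each factor is written as a sum over one coordinate of [z], so expanding the product gives a sum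
   over all vectors [z]. *)
rewrite (eq_bigr (fun i => \sum_(a : 'F_2) chi R (y 0 i * a) *: 'X^(a != 0)));
  last first.
  move=> i _; rewrite sum_F2 mulr0 mulr1 /chi !eqxx oner_eq0.
  by case: (y 0 i != 0); rewrite /= !expr0 !expr1 ?scale1r.
rewrite -(sum_rV_prod (fun i a => chi R (y 0 i * a) *: 'X^(a != 0))) coef_sum.
rewrite [RHS]big_mkcond /=; apply: eq_bigr => z _.
have -> : \prod_(i < N) (chi R (y 0 i * z 0 i) *: 'X^(z 0 i != 0)) =
    chi R (dotp y z) *: 'X^(wt z) :> {poly R}.
  rewrite scaler_prod -chi_sum; congr (_ *: _).
  rewrite -[RHS]mulr1 -[X in _ * X](expr1n _ (N - wt z)) -prod_exp_wt.
  by apply: eq_bigr => i _; case: (_ != 0).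
by rewrite coefZ coefXn eq_sym; case: eqP => _; rewrite ?mulr1 ?mulr0.
Qed.

(** * Elementary inequalities *)

Lemma expR_le_quadratic (R : realType) (t : R) :
  -(1 / 3) <= t -> t <= 1 / 3 -> expR t <= 1 + t + 3 / 4 * t ^+ 2.
Proof.
move=> t_ge t_le.
have u0 : 0 < 1 - t / 4 by lra.
(* The fourth power of this bound has quadratic coefficient [5 / 8], below the required [3 / 4];
   inverting [1 - t] directly would give [1]. *)
have h : expR (t / 4) <= (1 - t / 4)^-1.
  rewrite -[X in expR X]opprK expRN lef_pV2 ?posrE ?expR_gt0 //.
  exact: expR_ge1Dx.
have -> : t = 4%:R * (t / 4) by field.
rewrite expRM_natl; have -> : 4%:R * (t / 4) = t by field.
apply: (@le_trans _ _ ((1 - t / 4)^-1 ^+ 4)).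
  by rewrite lerXn2r ?nnegrE ?expR_ge0 // ltW // invr_gt0.
rewrite exprVn -[leLHS]mul1r ler_pdivrMr ?exprn_gt0 //.
rewrite -subr_ge0.
have -> : (1 + t + 3 / 4 * t ^+ 2) * (1 - t / 4) ^+ 4 - 1 =
    t ^+ 2 * (1 / 8 - 7 / 16 * t + 57 / 256 * t ^+ 2 - 11 / 256 * t ^+ 3
              + 3 / 1024 * t ^+ 4) by field.
apply: mulr_ge0; first exact: sqr_ge0.
(* The bracket is only barely positive at [t = 1 / 3]; [t1] and [t3] are chosen to be tight at that
   end. *)
have t2 := sqr_ge0 t; have t1 := sqr_ge0 (t - 1 / 3).
have t3 : 0 <= t ^+ 2 * (1 / 3 - t) by apply: mulr_ge0 => //; lra.
have t4 : 0 <= t ^+ 4 by rewrite exprn_even_ge0.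
by nra.
Qed.

Lemma leq_bin_half (n i j : nat) :
  (j <= i)%N -> (i.*2 <= n)%N -> ('C(n, j) <= 'C(n, i))%N.
Proof.
elim: i => [|i IH]; first by rewrite leqn0 => /eqP ->.
rewrite leq_eqVlt => /orP[/eqP -> //|ji] le_n.
apply: leq_trans (IH ji _) _; first by lia.
rewrite -(leq_pmul2l (ltn0Sn i)) mul_bin_left leq_mul2r; apply/orP; right; lia.
Qed.

(** * The dual code and averages of characters over it *)

Lemma dotpC (N : nat) (x y : 'rV['F_2]_N) : dotp x y = dotp y x.
Proof. by apply: eq_bigr => i _; rewrite mulrC. Qed.

Lemma dotpDl (N : nat) (x y z : 'rV['F_2]_N) : dotp (x + y) z = dotp x z + dotp y z.
Proof. by rewrite /dotp -big_split; apply: eq_bigr => i _; rewrite mxE mulrDl. Qed.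

Lemma dual_codeD (N : nat) (C : {vspace 'rV['F_2]_N}) (x y : 'rV['F_2]_N) :
  x \in dual_code C -> y \in dual_code C -> x + y \in dual_code C.
Proof.
rewrite !inE => /forall_inP xC /forall_inP yC; apply/forall_inP => z zC.
by rewrite dotpC dotpDl ![dotp _ z]dotpC (eqP (xC z zC)) (eqP (yC z zC)) addr0.
Qed.

Lemma card_dual_code_gt0 (N : nat) (C : {vspace 'rV['F_2]_N}) :
  (0 < #|dual_code C|)%N.
Proof.
apply/card_gt0P; exists 0; rewrite inE; apply/forall_inP => x _.
by rewrite /dotp big1 // => i _; rewrite mxE mulr0.
Qed.

Lemma rV2_addxx (N : nat) (y : 'rV['F_2]_N) : y + y = 0.
Proof.
by apply/rowP => i; rewrite !mxE; case: (F2P (y 0 i)) => ->; exact/val_inj.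
Qed.

(* A character of [C^\perp] averages to [1] if trivial and to [0] otherwise;
   since only this inequality is needed, biduality of codes is not. *)
Lemma Eunif_chi_ge (R : realType) (N : nat) (C : {vspace 'rV['F_2]_N})
    (z : 'rV['F_2]_N) :
  (z \in C)%:R <= Eunif (dual_code C) (fun y => chi R (dotp y z)).
Proof.
have D0 : 0 < #|dual_code C|%:R :> R by rewrite ltr0n card_dual_code_gt0.
have triv : (forall y, y \in dual_code C -> dotp y z = 0) ->
    Eunif (dual_code C) (fun y => chi R (dotp y z)) = 1.
  move=> y0; rewrite /Eunif (eq_bigr (fun=> 1)) => [|y /y0 ->].
    by rewrite sumr_const divff // gt_eqF.
  by rewrite /chi eqxx.
have [zC|zC] := boolP (z \in C).
  rewrite triv // => y; rewrite inE => /forall_inP /(_ z zC) /eqP.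
  by rewrite dotpC.
have [/forall_inP y0|] := boolP [forall y in dual_code C, dotp y z == 0].
  by rewrite triv ?ler01 // => y yC; apply/eqP/y0.
rewrite negb_forall => /existsP[y0]; rewrite negb_imply => /andP[y0C y0z].
(* Translation by [y0] permutes the dual code and flips the sign of the character, so the sum equals
   its own negative. *)
have opp (y : 'rV['F_2]_N) : chi R (dotp (y + y0) z) = - chi R (dotp y z).
  by rewrite dotpDl chiD {2}/chi y0z expr1 mulrN1.
rewrite /Eunif; set s := \sum_(y in _) _.
suff sN : s = - s.
  by have -> : s = 0; [lra|rewrite mul0r].
rewrite {1}/s (reindex_inj (addIr y0)) /= -sumrN; apply: eq_big => [y|y _].
  apply/idP/idP => yC; last exact: dual_codeD.
  by rewrite -[y]addr0 -(rV2_addxx y0) addrA; exact: dual_codeD.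
exact: opp.
Qed.

Lemma Eunif_sum (R : realType) (T I : finType) (P : pred I) (X : {set T})
    (f : I -> T -> R) :
  Eunif X (fun y => \sum_(i | P i) f i y) = \sum_(i | P i) Eunif X (f i).
Proof. by rewrite /Eunif exchange_big mulr_suml. Qed.

(** At [y = 0] every character value is [1], so the size of the sphere is the Krawtchouk value at
    [0], where only the term [j = 0] survives. *)
Lemma sum_sphere1 (R : realType) (N s : nat) :
  \sum_(z : 'rV['F_2]_N | wt z == s) 1 = 'C(N, s)%:R :> R.
Proof.
have wt0 : wt (0 : 'rV['F_2]_N) = 0%N.
  by apply/eqP; rewrite cards_eq0; apply/eqP/setP => i; rewrite !inE mxE eqxx.
transitivity (Krawtchouk R N s).[(wt (0 : 'rV['F_2]_N))%:R].
  rewrite Krawtchouk_chi; apply: eq_bigr => z _.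
  rewrite /dotp big1 ?/chi ?eqxx // => i _; by rewrite mxE mul0r.
rewrite wt0 /Krawtchouk horner_sum big_ord_recl big1 => [|j _].
  rewrite addr0 expr0 scale1r hornerM (@binp_horner _ _ _ 0) ?hornerX //.
  rewrite (@binp_horner _ _ _ N) ?mul1r ?subn0 //.
  by rewrite hornerD hornerN hornerX subr0 -polyC_natr hornerC.
by rewrite hornerZ hornerM (@binp_horner _ _ _ 0) ?hornerX // mul0r mulr0.
Qed.

Lemma sum_wt_partition (A : nmodType) (N : nat) (W : pred nat)
    (f : 'rV['F_2]_N -> A) :
  \sum_(z | W (wt z)) f z = \sum_(i < N.+1 | W i) \sum_(z | wt z == i) f z.
Proof.
rewrite (partition_big (fun z => inord (wt z) : 'I_N.+1) (fun i => W i)) /=.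
  apply: eq_bigr => i Wi; apply: eq_bigl => z.
  rewrite -val_eqE /= inordK ?ltnS ?wt_le //.
  by case: eqP => [->|]; rewrite ?Wi ?andbF.
by move=> z; rewrite inordK ?ltnS ?wt_le.
Qed.

(** * Collisions and the second moment of Krawtchouk sums *)

Definition collisions (R : realType) (N : nat) (C : {vspace 'rV['F_2]_N})
    (i j : nat) : R :=
  \sum_(z | wt z == i) \sum_(z' | wt z' == j) ((z != z') && (z - z' \in C))%:R.

Lemma collisions_ge0 (R : realType) (N : nat) (C : {vspace 'rV['F_2]_N})
    (i j : nat) : 0 <= collisions R C i j.
Proof. by do 2!apply: sumr_ge0 => ? _; exact: ler0n. Qed.

Lemma collisionsC (R : realType) (N : nat) (C : {vspace 'rV['F_2]_N})
    (i j : nat) : collisions R C i j = collisions R C j i.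
Proof.
rewrite /collisions exchange_big; apply: eq_bigr => z _; apply: eq_bigr => z' _.
by rewrite eq_sym -opprB memvN.
Qed.

Lemma chi_dotpB (R : realType) (N : nat) (y z z' : 'rV['F_2]_N) :
  chi R (dotp y (z - z')) = chi R (dotp y z) * chi R (dotp y z').
Proof.
have -> : - z' = z' by apply/esym/eqP; rewrite -addr_eq0 rV2_addxx.
by rewrite dotpC dotpDl chiD ![dotp _ y]dotpC.
Qed.

Lemma KrawtchoukS_second_moment (R : realType) (N : nat)
    (C : {vspace 'rV['F_2]_N}) (S : {set 'I_N.+1}) :
  (binom_set S)%:R + \sum_(i in S) \sum_(j in S) collisions R C i j <=
  Eunif (dual_code C) (fun y => (KrawtchoukS R S).[(wt y)%:R] ^+ 2).
Proof.
have -> : (fun y => (KrawtchoukS R S).[(wt y)%:R] ^+ 2) =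
    (fun y => \sum_(i in S) \sum_(j in S) \sum_(z : 'rV['F_2]_N | wt z == i)
      \sum_(z' | wt z' == j) chi R (dotp y (z - z'))).
  apply/funext => y; rewrite /KrawtchoukS horner_sum expr2 mulr_suml.
  apply: eq_bigr => i _; rewrite mulr_sumr; apply: eq_bigr => j _.
  rewrite !Krawtchouk_chi mulr_suml; apply: eq_bigr => z _.
  by rewrite mulr_sumr; apply: eq_bigr => z' _; rewrite chi_dotpB.
rewrite Eunif_sum /binom_set natr_sum -big_split /=.
apply: ler_sum => i iS; rewrite Eunif_sum.
(* The diagonal count is spread over all pairs, first as indicators of [i = j] and then of [z = z'],
   so that the inequality reduces to [Eunif_chi_ge] at each [z - z']. *)
have -> : 'C(N, i)%:R = \sum_(j in S) (i == j)%:R * 'C(N, i)%:R :> R.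
  rewrite (bigD1 i) //= eqxx mul1r big1 ?addr0 // => j /andP[_].
  by rewrite eq_sym => /negbTE ->; rewrite mul0r.
rewrite -big_split /=; apply: ler_sum => j jS; rewrite Eunif_sum.
rewrite -sum_sphere1 mulr_sumr -big_split /=; apply: ler_sum => z /eqP zi.
rewrite Eunif_sum mulr1.
have -> : (i == j)%:R = \sum_(z' : 'rV['F_2]_N | wt z' == j) (z == z')%:R :> R.
  have [ij|ij] := eqVneq i j.
    rewrite (bigD1 z) ?zi ?ij //= eqxx big1 ?addr0 // => z' /andP[_].
    by rewrite eq_sym => /negbTE ->.
  rewrite big1 // => z' /eqP z'j; case: eqVneq => // zz'.
  by case/eqP: ij; apply/val_inj; rewrite /= -zi -z'j zz'.
rewrite -big_split /=; apply: ler_sum => z' _.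
apply: le_trans (Eunif_chi_ge R C (z - z')).
by have [->|_] := eqVneq z z'; rewrite ?subrr ?mem0v /= ?addr0 ?add0r.
Qed.

(** * The decoder *)

Lemma min_weight_decoder (N : nat) (C : {vspace 'rV['F_2]_N}) (W : pred nat) :
  exists d : 'rV['F_2]_N -> 'rV['F_2]_N,
    (forall x, d x \in C) /\
    (forall c rho, c \in C -> W (wt rho) -> d (c + rho) != c ->
      exists z, [/\ W (wt z), (wt z <= wt rho)%N, rho != z & rho - z \in C]).
Proof.
pose ok x c := (c \in C) && W (wt (x - c)).
(* The default [0] only makes [d] total: for an error with weight in [W], the sent codeword itself
   is a candidate. *)
pose d x := if [pick c | ok x c] is Some c0
  then [arg min_(c < c0 | ok x c) wt (x - c)] else 0.
exists d; split=> [x|c rho cC Wrho dc].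
  rewrite /d; case: pickP => [c0 ok0|_]; last exact: mem0v.
  by case: arg_minnP => // c /andP[].
have okc : ok (c + rho) c by rewrite /ok cC addrAC subrr add0r.
(* The witness is the error pattern inferred by the decoder; it differs from [rho] by a codeword. *)
exists (c + rho - d (c + rho)).
have [ok1 le1] : ok (c + rho) (d (c + rho)) /\
    (wt (c + rho - d (c + rho))%R <= wt (c + rho - c)%R)%N.
  rewrite /d; case: pickP => [c0 ok0|none]; last by have := none c; rewrite okc.
  by case: arg_minnP => // c1 ok1 /(_ c okc).
have errE : rho - (c + rho - d (c + rho)) = d (c + rho) - c.
  by rewrite opprB addrCA opprD [rho + _]addrCA subrr addr0.
case/andP: ok1 => dC Wd; split=> //.
- by move: le1; rewrite [c + rho - c]addrAC subrr add0r.
- by rewrite -subr_eq0 errE subr_eq0.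
- by rewrite errE memvB.
Qed.

(** * Chernoff bound for the weight of the noise *)

Lemma expR_moment (R : realType) (N : nat) (eps t : R) :
  0 <= eps -> eps <= 1 -> -(1 / 3) <= t -> t <= 1 / 3 ->
  \sum_(z : 'rV['F_2]_N) Pnoise eps z * expR (t * ((wt z)%:R - eps * N%:R)) <=
  expR (3 / 4 * eps * N%:R * t ^+ 2).
Proof.
move=> eps0 eps1 t_ge t_le.
have -> : \sum_(z : 'rV['F_2]_N) Pnoise eps z * expR (t * ((wt z)%:R - eps * N%:R)) =
    (eps * expR t + (1 - eps)) ^+ N * expR (- (t * eps * N%:R)).
  rewrite -sum_wt_prod mulr_suml; apply: eq_bigr => z _.
  rewrite /Pnoise exprMn -expRM_natl mulrBr expRD mulrA [t * (eps * _)]mulrA.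
  by rewrite [t * _%:R]mulrC; ring.
(* By [1 + x <= expR x]; the linear term [eps * t] then cancels against the centring, leaving only
   the quadratic exponent. *)
have base : eps * expR t + (1 - eps) <= expR (eps * (t + 3 / 4 * t ^+ 2)).
  apply: le_trans (expR_ge1Dx _).
  by have := ler_wpM2l eps0 (expR_le_quadratic t_ge t_le); lra.
apply: (@le_trans _ _ (expR (eps * (t + 3 / 4 * t ^+ 2)) ^+ N *
    expR (- (t * eps * N%:R)))).
  rewrite ler_wpM2r ?expR_ge0 // lerXn2r ?nnegrE ?expR_ge0 //.
  by rewrite addr_ge0 ?subr_ge0 // mulr_ge0 ?expR_ge0.
by rewrite -expRM_natl -expRD ler_expR; lra.
Qed.

Lemma Pnoise_ge0 (R : realType) (N : nat) (eps : R) (z : 'rV['F_2]_N) :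
  0 <= eps -> eps <= 1 -> 0 <= Pnoise eps z.
Proof. by move=> e0 e1; rewrite mulr_ge0 ?exprn_ge0 ?subr_ge0. Qed.

Lemma sum_Pnoise (R : realType) (N : nat) (eps : R) :
  \sum_(z : 'rV['F_2]_N) Pnoise eps z = 1.
Proof. by rewrite sum_wt_prod addrC subrK expr1n. Qed.

(** Markov's inequality for the exponential moment. The sign of [t] selects the tail, so one
    statement serves both. *)
Lemma noise_one_sided_tail (R : realType) (N : nat) (eps t a : R)
    (A : pred 'rV['F_2]_N) :
  0 <= eps -> eps <= 1 -> -(1 / 3) <= t -> t <= 1 / 3 ->
  (forall z, A z -> a <= t * ((wt z)%:R - eps * N%:R)) ->
  Prob (Pnoise eps) A <= expR (3 / 4 * eps * N%:R * t ^+ 2 - a).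
Proof.
move=> eps0 eps1 t_ge t_le Aa; rewrite expRD expRN ler_pdivlMr ?expR_gt0 //.
apply: le_trans (expR_moment N eps0 eps1 t_ge t_le).
rewrite /Prob mulr_suml big_mkcond /=; apply: ler_sum => z _.
case: ifP => [Az|_]; last by rewrite mulr_ge0 ?expR_ge0 ?Pnoise_ge0.
by rewrite ler_wpM2l ?Pnoise_ge0 // ler_expR Aa.
Qed.

(* The constant [t = 2 / (3 q eps)] minimises
   [3 / 4 * eps * q ^ 4 * t ^ 2 - t * q ^ 3]. *)
Lemma noise_tail (R : realType) (N : nat) (eps q : R) :
  0 < eps -> eps <= 1 -> 0 < q -> q ^+ 4 = N%:R -> 2 <= q * eps ->
  Prob (Pnoise eps) (fun z : 'rV['F_2]_N =>
    ~~ (eps * N%:R - q ^+ 3 <= (wt z)%:R <= eps * N%:R + q ^+ 3)) <=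
  2 * expR (- (q ^+ 2 / (3 * eps))).
Proof.
move=> eps0 eps1 q0 qN qe.
have qe0 : 0 < q * eps by rewrite mulr_gt0.
pose t := 2 / (3 * (q * eps)).
have t0 : 0 < t by rewrite divr_gt0 ?mulr_gt0.
(* The assumption [2 <= q * eps] is exactly what keeps [t] in the range of [expR_le_quadratic]. *)
have t1 : t <= 1 / 3 by rewrite ler_pdivrMr ?mulr_gt0 //; lra.
have tN1 : - (1 / 3) <= - t by rewrite lerN2.
have e : 3 / 4 * eps * N%:R * t ^+ 2 - t * q ^+ 3 = - (q ^+ 2 / (3 * eps)).
  by rewrite -qN /t; field; rewrite !gt_eqF.
pose up := fun z : 'rV['F_2]_N => eps * N%:R + q ^+ 3 < (wt z)%:R.
pose lo := fun z : 'rV['F_2]_N => (wt z)%:R < eps * N%:R - q ^+ 3.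
apply: (@le_trans _ _ (Prob (Pnoise eps) lo + Prob (Pnoise eps) up)).
  rewrite /Prob big_mkcond [X in _ <= X + _]big_mkcond [X in _ <= _ + X]big_mkcond.
  rewrite -big_split /=; apply: ler_sum => z _.
  have Pz := Pnoise_ge0 z (ltW eps0) eps1.
  rewrite negb_and -!ltNge /lo /up.
  by case: (_ < _); case: (_ < _) => /=; lra.
have -> : 2 * expR (- (q ^+ 2 / (3 * eps))) =
  expR (- (q ^+ 2 / (3 * eps))) + expR (- (q ^+ 2 / (3 * eps))) by ring.
have bnd := noise_one_sided_tail (ltW eps0) eps1; apply: lerD.
  rewrite -e -[t ^+ 2]sqrrN; apply: bnd => //; first lra.
  by move=> z; rewrite /lo => lz; nra.
rewrite -e; apply: bnd => //; first lra.
by move=> z; rewrite /up => lz; nra.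
Qed.

(** * From collision counts to the error probability *)

(* For distinct [i] and [j] the set [S = {i, j}] counts the collisions between
   the two spheres twice, which makes up for [binom_set S <= 2 'C(N, i)]. *)
Lemma collisions_le (R : realType) (N : nat) (C : {vspace 'rV['F_2]_N})
    (W : pred 'I_N.+1) (M : R) (i j : 'I_N.+1) :
  (forall S : {set 'I_N.+1}, (forall k, k \in S -> W k) -> (1 <= #|S| <= 2)%N ->
    1 / (binom_set S)%:R *
      Eunif (dual_code C) (fun y => (KrawtchoukS R S).[(wt y)%:R] ^+ 2) - 1 <= M) ->
  0 <= M -> W i -> W j -> (j <= i)%N -> (i.*2 <= N)%N ->
  collisions R C i j <= M * 'C(N, i)%:R.
Proof.
move=> bndM M0 Wi Wj le_ji le_iN.
have bin_ge0 (k : 'I_N.+1) : 0 < 'C(N, k)%:R :> R.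
  by rewrite ltr0n bin_gt0 -ltnS.
have sum_le (S : {set 'I_N.+1}) : 0 < (binom_set S)%:R :> R ->
    (forall k, k \in S -> W k) -> (1 <= #|S| <= 2)%N ->
    \sum_(k in S) \sum_(l in S) collisions R C k l <= M * (binom_set S)%:R.
  move=> B0 WS cS; have := bndM S WS cS.
  rewrite lerBlDr mul1r ler_pdivrMl // => leM.
  by have := KrawtchoukS_second_moment R C S; lra.
have [ij|ij] := eqVneq i j.
  have := sum_le [set i]; rewrite /binom_set !big_set1 -ij; apply=> //.
    by move=> k /set1P ->.
  by rewrite cards1.
have i_j : i \notin [set j] by rewrite inE.
have := sum_le (i |: [set j]); rewrite /binom_set !big_setU1 //= !big_set1.
rewrite !big_setU1 //= !big_set1 natrD cards2 ij => /(_ _ _ isT) H.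
have {}H := H (addr_gt0 (bin_ge0 i) (bin_ge0 j)).
have {}H : collisions R C i i + collisions R C i j +
    (collisions R C j i + collisions R C j j) <=
    M * ('C(N, i)%:R + 'C(N, j)%:R).
  by apply: H => k; rewrite !inE => /orP[]/eqP ->.
have ii := collisions_ge0 R C i i; have jj := collisions_ge0 R C j j.
have binle : 'C(N, j)%:R <= 'C(N, i)%:R :> R by rewrite ler_nat leq_bin_half.
have := ler_wpM2l M0 binle.
by move: H; rewrite (collisionsC R C j i); lra.
Qed.

Lemma decoding_error_le (R : realType) (N : nat) (C : {vspace 'rV['F_2]_N})
    (eps M : R) (W : pred nat) :
  0 <= eps -> eps <= 1 -> 0 <= M -> (forall i, W i -> i < N)%N ->
  (forall i j, W i -> W j -> (j <= i)%N -> collisions R C i j <= M * 'C(N, i)%:R) ->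
  exists d : 'rV['F_2]_N -> 'rV['F_2]_N,
    (forall x, d x \in C) /\
    (forall c, c \in C -> Prob (Pnoise eps) (fun rho => d (c + rho) != c) <=
      Prob (Pnoise eps) (fun z : 'rV['F_2]_N => ~~ W (wt z)) + N%:R * M).
Proof.
move=> eps0 eps1 M0 WN collM.
have P0 (z : 'rV['F_2]_N) := Pnoise_ge0 z eps0 eps1.
have [d [dC dP]] := min_weight_decoder C W.
exists d; split=> // c cC.
pose conf (z z' : 'rV['F_2]_N) : R := ((z != z') && (z - z' \in C))%:R.
apply: (@le_trans _ _ (Prob (Pnoise eps) (fun z : 'rV['F_2]_N => ~~ W (wt z)) +
  \sum_(z : 'rV['F_2]_N | W (wt z)) Pnoise eps z *
    \sum_(z' : 'rV['F_2]_N | W (wt z') && (wt z' <= wt z)%N) conf z z')).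
  rewrite /Prob [leLHS]big_mkcond [X in _ <= X + _]big_mkcond.
  rewrite [X in _ <= _ + X]big_mkcond -big_split /=; apply: ler_sum => z _.
  have s0 : 0 <= \sum_(z' : 'rV['F_2]_N | W (wt z') && (wt z' <= wt z)%N) conf z z'.
    by apply: sumr_ge0 => *; exact: ler0n.
  have [Wz|Wz] /= := boolP (W (wt z)); last by rewrite addr0; case: ifP.
  rewrite add0r; case: ifP => [dz|_]; last exact: mulr_ge0.
  have [z' [Wz' le_z' zz' zC]] := dP c z cC Wz dz.
  (* The single conflicting [z'] supplied by the decoder already makes the inner sum at least
     [1]. *)
  rewrite -[leLHS]mulr1 ler_wpM2l // (bigD1 z') /= ?Wz' //.
  by rewrite /conf zz' zC lerDl; apply: sumr_ge0 => *; exact: ler0n.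
rewrite lerD2l sum_wt_partition.
apply: (@le_trans _ _ (\sum_(i < N.+1 | W i)
    \sum_(z : 'rV['F_2]_N | wt z == i) Pnoise eps z * (N%:R * M))); last first.
  rewrite -(sum_wt_partition W (fun z => Pnoise eps z * (N%:R * M))) -mulr_suml.
  rewrite -[leRHS]mul1r ler_wpM2r ?mulr_ge0 // -(sum_Pnoise N eps).
  by rewrite big_mkcond; apply: ler_sum => z _; case: ifP.
(* Sphere by sphere: all errors of weight [i] have the same probability [p], so the conflict sum
   becomes [p] times collision counts. *)
apply: ler_sum => i Wi.
pose p : R := eps ^+ i * (1 - eps) ^+ (N - i).
have p0 : 0 <= p by rewrite mulr_ge0 ?exprn_ge0 ?subr_ge0.
have -> : \sum_(z : 'rV['F_2]_N | wt z == i) Pnoise eps z * (N%:R * M) =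
    p * (N%:R * (M * 'C(N, i)%:R)).
  rewrite -mulr_suml (eq_bigr (fun=> p * 1)) => [|z /eqP zi].
    by rewrite -mulr_sumr sum_sphere1; ring.
  by rewrite /Pnoise zi mulr1.
have -> : \sum_(z : 'rV['F_2]_N | wt z == i) Pnoise eps z *
      \sum_(z' : 'rV['F_2]_N | W (wt z') && (wt z' <= wt z)%N) conf z z' =
    p * \sum_(j < N.+1 | W j && (j <= i)%N) collisions R C i j.
  rewrite /collisions exchange_big mulr_sumr; apply: eq_bigr => z /eqP zi.
  rewrite /Pnoise zi -/p; congr (_ * _).
  by rewrite (sum_wt_partition (fun k => W k && (k <= i)%N)).
rewrite ler_wpM2l //.
have MC0 : 0 <= M * 'C(N, i)%:R by rewrite mulr_ge0.
(* Of the [N.+1] possible weights [j], the last one [N] lies outside [W]; this gives the factor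
   [N]. *)
rewrite big_mkcond big_ord_recr /= ifN ?addr0; last first.
  by apply/negP => /andP[/WN]; rewrite ltnn.
apply: (@le_trans _ _ (\sum_(j < N) M * 'C(N, i)%:R)).
  by apply: ler_sum => j _; case: ifP => // /andP[Wj ji]; exact: collM.
by rewrite sumr_const card_ord mulr_natl.
Qed.

Theorem theorem1p2 (R : realType) (N : nat) (C : {vspace 'rV['F_2]_N}) (eps : R)
  (eps_gt0 : 0 < eps) (eps_lt_half : eps < 1 / 2)
  (N_large : 1 / (eps ^+ 4 * (1 / 2 - eps) ^+ 4) < N%:R) :
  exists d : 'rV['F_2]_N -> 'rV['F_2]_N,
    (forall x : 'rV['F_2]_N, d x \in C) /\
    (forall c : 'rV['F_2]_N, c \in C ->
      Prob (Pnoise eps) (fun rho => d (c + rho) != c) <=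
        2 * expR (- (Num.sqrt N%:R / (3 * eps))) +
        N%:R * finmax (@in_window R N eps) (fun S : {set 'I_N.+1} =>
          1 / (binom_set S)%:R *
            Eunif (dual_code C) (fun y => (KrawtchoukS R S).[(wt y)%:R] ^+ 2) - 1)).
Proof.
set F := fun S : {set 'I_N.+1} => _; set M := finmax _ _.
have eps1 : eps <= 1 by lra.
(* With [q] the fourth root of [N], the window has radius [q ^+ 3] and the tail exponent involves
   [q ^+ 2]. *)
pose q : R := N%:R `^ (1 / 4).
have q4 : q ^+ 4 = N%:R.
  by rewrite -powR_mulrn ?powR_ge0 // -powRrM div1r mulVf // powRr1.
have q3 : q ^+ 3 = N%:R `^ (3 / 4).
  by rewrite -powR_mulrn ?powR_ge0 // -powRrM; congr (_ `^ _); field.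
have q2 : q ^+ 2 = Num.sqrt N%:R.
  by rewrite -powR_mulrn ?powR_ge0 // -powRrM -powR12_sqrt //; congr (_ `^ _); field.
have h0 : 0 < 1 / 2 - eps by lra.
have e0 : 0 < eps * (1 / 2 - eps) by exact: mulr_gt0.
have q_ge0 : 0 <= q by exact: powR_ge0.
(* The fourth root of the hypothesis [N_large]; the bounds [qe] and [q1h] both follow from it. *)
have qh : 1 < q * (eps * (1 / 2 - eps)).
  rewrite -(@ltr_pXn2r _ 4) ?nnegrE ?(mulr_ge0 q_ge0 (ltW e0)) //.
  by rewrite expr1n !exprMn q4 -ltr_pdivrMr // mulr_gt0 // exprn_gt0.
have q0 : 0 < q.
  by rewrite lt_def q_ge0 andbT; apply/eqP => q00; move: qh; rewrite q00 mul0r ltr10.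
have qeps0 : 0 < q * eps by exact: mulr_gt0.
have qe : 2 <= q * eps.
  have : 0 < q * eps * eps by exact: mulr_gt0.
  by move: qh; rewrite mulrA mulrBr; lra.
have q1h : 1 < q * (1 / 2 - eps).
  have : 0 <= q * (1 / 2 - eps) * (1 - eps).
    by rewrite !mulr_ge0 ?(ltW h0) ?subr_ge0.
  by move: qh; rewrite mulrCA mulrC [_ * (1 - eps)]mulrBr mulr1; lra.
pose W (i : nat) := eps * N%:R - q ^+ 3 <= i%:R <= eps * N%:R + q ^+ 3.
(* Since [q * (1 / 2 - eps) > 1], the radius [q ^+ 3] is less than [N * (1 / 2 - eps)]. *)
have Whalf i : W i -> (i.*2 < N)%N.
  case/andP=> _ le_i; rewrite -(ltr_nat R) -muln2 natrM -q4.
  have : q ^+ 3 < q ^+ 3 * (q * (1 / 2 - eps)) by rewrite ltr_pMr ?exprn_gt0.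
  by rewrite -q4 in le_i; nra.
have windowE (S : {set 'I_N.+1}) : (forall k, k \in S -> W k) ->
    (1 <= #|S| <= 2)%N -> in_window eps S.
  by move=> WS cS; rewrite /in_window cS andbT -q3; apply/forall_inP.
have leM (S : {set 'I_N.+1}) : in_window eps S -> F S <= M.
  by rewrite /M => PS; have [S0 _ [-> leS0]] := finmaxP F PS; exact: leS0.
have M0 : 0 <= M.
  (* If no set fits the window, [M] is the supremum of the empty set, which is [0]; otherwise the
     second moment is at least [binom_set S0], so [F S0] is nonnegative. *)
  have [S0 PS0|none] := pickP (@in_window R N eps); last first.
    rewrite /M /finmax (_ : [set F x | x in _]%classic = set0) ?sup0 //.
    by rewrite -subset0 => _ [S /= + _]; rewrite none.
  apply: le_trans (leM _ PS0); rewrite /F subr_ge0 mul1r.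
  have [B0|B0] := posnP (binom_set S0).
    case/andP: PS0 => _ /andP[/card_gt0P[k kS] _].
    move/eqP: B0; rewrite /binom_set sum_nat_eq0 => /forall_inP /(_ k kS).
    by rewrite eqn0Ngt bin_gt0 -ltnS ltn_ord.
  rewrite ler_pdivlMl ?ltr0n // mulr1.
  apply: le_trans (KrawtchoukS_second_moment R C S0); rewrite lerDl.
  by do 2!apply: sumr_ge0 => ? _; exact: collisions_ge0.
have WN i : W i -> (i < N)%N.
  by move/Whalf; apply: leq_ltn_trans; rewrite -addnn leq_addr.
have [|d [dC dP]] := @decoding_error_le R N C eps M W (ltW eps_gt0) eps1 M0 WN.
  move=> i j Wi Wj ji.
  have iN : (i < N.+1)%N by rewrite ltnS ltnW ?WN.
  have jN : (j < N.+1)%N by rewrite ltnS ltnW ?WN.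
  apply: (@collisions_le R N C (fun k => W k) M (Ordinal iN) (Ordinal jN)) => //.
    by move=> S WS cS; apply: leM; exact: windowE.
  by rewrite ltnW // Whalf.
exists d; split=> // c cC; apply: le_trans (dP c cC) _.
by rewrite lerD2r -q2; exact: noise_tail.
Qed.
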